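(* Let $k\geq 4$ and $n\geq 71k^2$. If $\mathcal F\subset\binom{[n]}{k}$ is intersecting, then \[ \gamma_3(\mathcal F)\leq 3\binom{n-7}{k-4}+108k\binom{n-8}{k-5}. \]
   Context: A family is intersecting if any two of its members intersect. For $S\subset[n]$, $\mathcal F(\overline S)=\{F\in\mathcal F: F\cap S=\emptyset\}$, and $\gamma_3(\mathcal F)=\min_{S\in\binom{[n]}{3}}|\mathcal F(\overline S)|$. Binomial coefficients $\binom{a}{b}$ are $0$ when $b<0$. *)

(* Defs.v *)
From mathcomp Require Import all_boot all_algebra.
Set Implicit Arguments. Unset Strict Implicit. Unset Printing Implicit Defensive.

Definition intersecting n (F : {set {set 'I_n}}) : bool :=
  [forall A in F, forall B in F, A :&: B != set0].

Definition avoid n (F : {set {set 'I_n}}) (S : {set 'I_n}) : {set {set 'I_n}} :=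
  [set A in F | [disjoint A & S]].

(* gamma_3(F) = min over 3-subsets S of |F(\bar S)|.  The seed #|F| of the
   iterated minimum is an upper bound of every term, so for n >= 3 this is the
   true minimum. *)
Definition gamma3 n (F : {set {set 'I_n}}) : nat :=
  \big[minn/#|F|]_(S : {set 'I_n} | #|S| == 3) #|avoid F S|.

Definition binomz (a : nat) (b : int) : nat :=
  match b with Posz m => 'C(a, m) | Negz _ => 0 end.

(* Main.v *)
(** Replace F by smaller and smaller generating families.  Let U be a maximal
    intersecting family of sets of size at most l in which every member of F
    contains a member.  The l-sets of U without a proper subset in U are minimal
    transversals of U, so branching on members of U, all of size at most l,
    shows that there are at most l^l of them; they generate at most
    l^l C(n-l-3, k-l) members of F avoiding a given triple, and the remaining
    members of U have size at most l-1.  Descending from l = k to l = 6, the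
    total loss is O(C(n-8, k-5)) because n >= 71 k^2.

    At l = 5 let G be the members of size at most 4.  If a triple S meets all of
    G, only the at most 5^5 minimal 5-sets count.  Otherwise G is 4-uniform, and
    it has an edge A and a point e of A such that at most three edges of G meet
    A exactly in e.  With S = A \ {e} the edges of G contribute at most
    3 C(n-7, k-4), and branching shows that at most 3*3*3*4 = 108 minimal 5-sets
    avoid S.

    The statement on 4-graphs (sharp for the projective plane of order 3) is
    obtained by assuming that four edges meet A exactly in e for every flag (A, e)
    and running a verified exhaustive search from two edges sharing three points,
    then from two edges sharing two points; linear 4-graphs are easy. *)
Require Import Defs.
From mathcomp Require Import all_boot all_algebra.
From mathcomp Require Import zify.
Set Implicit Arguments. Unset Strict Implicit. Unset Printing Implicit Defensive.

(** * A reflective search on intersecting 4-graphs *)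

(* A set of vertices is coded as a mask over the list of vertices discovered so
   far.  [K] codes the known edges; [C] contains the trace of every edge on the
   discovered vertices, with at most four points, minus the traces that earlier
   branches have excluded. *)
Fixpoint inter (X Y : bitseq) : nat :=
  match X, Y with
  | a :: X', b :: Y' => if a && b then (inter X' Y').+1 else inter X' Y'
  | _, _ => 0
  end.

Fixpoint same (X Y : bitseq) : bool :=
  match X, Y with
  | a :: X', b :: Y' => if (if a then b else ~~ b) then same X' Y' else false
  | [::], [::] => true
  | _, _ => false
  end.

Fixpoint bits (n : nat) : seq bitseq :=
  if n is n'.+1 then
    [seq true :: Z | Z <- bits n'] ++ [seq false :: Z | Z <- bits n']
  else [:: [::]].

(* The value 4 ([c] = 3) stands for the known edge [N] itself. *)
Definition compat m (N W : bitseq) : bool :=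
  if inter W N is c.+1 then
    if (c < m) || (c == 3) then count id W <= 4 else false
  else false.

(* If every flag is met by at least four edges in its point only, at least
   [4 - known] of the edges meeting [E] exactly in its [i]-th point are unknown.
   When all candidates are full edges they are therefore numerous enough for one
   of them to survive the removal of the last [3 - known] candidates. *)
Definition narrow K C (E : bitseq) (best : seq bitseq) (i : nat) :=
  if nth false E i then
    let known := count (nth false ^~ i) K in
    let unknown := [seq X <- C | nth false X i] in
    let unknown :=
      if all (fun X => count id X == 4) unknown
      then take (size unknown + known - 3) unknown else unknown in
    if (known < 4) && (size unknown < size best) then unknown else best
  else best.

(** Any of the lists compared would be sound to branch on; a short one keeps the search tree
    small. *)
Fixpoint choose K C Es best : seq bitseq :=
  if Es is E :: Es' then
    if size best <= 1 then best else
    let K1 := [seq X <- K | if inter X E is 1 then true else false] in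
    let C1 := [seq X <- C | if inter X E is 1 then ~~ has (same X) K else false] in
    choose K C Es' (foldl (narrow K1 C1 E) best (iota 0 (size E)))
  else best.

(** If an edge has trace [X], its other [f] points are new vertices, appended to every mask;
    candidates extend over them in all ways. A refuted [X] is the trace of no edge, so later
    branches drop it from [C]. *)
Fixpoint refute_all (r : seq bitseq -> seq bitseq -> bool) m K C op : bool :=
  if op is X :: op' then
    let f := 4 - count id X in
    let N := X ++ nseq f true in
    let K' := N :: [seq E ++ nseq f false | E <- K] in
    let C' := [seq W <- [seq Y ++ Z | Y <- C, Z <- bits f] | compat m N W] in
    if r K' C' then refute_all r m K [seq Y <- C | ~~ same Y X] op' else false
  else true.

(** [d] is fuel: running out yields [false], so [true] always comes from a finished search. [choose]
    starts from [C] because every edge has its trace there. *)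
Fixpoint refute d m K C : bool :=
  if d is d'.+1 then refute_all (refute d' m) m K C (choose K C K C) else false.

Definition refute_start m K : bool :=
  refute 40 m K [seq W <- bits (size (head [::] K)) | all (compat m ^~ W) K].


Lemma sameP X Y : reflect (X = Y) (same X Y).
Proof.
elim: X Y => [|a X IH] [|b Y] /=; try by constructor.
case: a b => [] [] /=; try by constructor.
- by apply: (iffP (IH Y)) => [->|[]].
- by apply: (iffP (IH Y)) => [->|[]].
Qed.

Lemma bitsP Z : Z \in bits (size Z).
Proof.
elim: Z => //= a Z IH; rewrite mem_cat.
by case: a; rewrite ?(map_f _ IH) ?orbT.
Qed.

Definition meeting_pair d : seq bitseq :=
  [:: nseq d true ++ nseq (4 - d) true ++ nseq (4 - d) false;
      nseq d true ++ nseq (4 - d) false ++ nseq (4 - d) true].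

Lemma refute_meet3 : refute_start 3 (meeting_pair 3).
Proof. vm_cast_no_check (erefl true). Qed.

Lemma refute_meet2 : refute_start 2 (meeting_pair 2).
Proof. vm_cast_no_check (erefl true). Qed.

(** * Soundness of the search *)

Section Soundness.
Variable T : finType.
Implicit Types (vs : seq T) (E F : {set T}) (X Y Z : bitseq) (K C op : seq bitseq).

Definition trace vs E : bitseq := [seq x \in E | x <- vs].

Lemma inter_trace vs E F :
  inter (trace vs E) (trace vs F) = count (mem (E :&: F)) vs.
Proof. by elim: vs => //= x vs ->; rewrite !inE; case: (_ && _). Qed.

Lemma count_trace vs E : count id (trace vs E) = count (mem E) vs.
Proof. by rewrite count_map. Qed.

Lemma count_mem_set vs E : uniq vs -> count (mem E) vs = #|[set x in E | x \in vs]|.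
Proof.
move=> Uvs; rewrite -size_filter cardE; apply: perm_size; apply: uniq_perm.
- exact: filter_uniq.
- exact: enum_uniq.
by move=> x; rewrite mem_filter mem_enum !inE.
Qed.

Lemma count_mem_sub vs E : uniq vs -> {subset E <= vs} -> count (mem E) vs = #|E|.
Proof.
move=> Uvs sEvs; rewrite count_mem_set //; congr #|pred_of_set _|.
by apply/setP=> x; rewrite inE; case xE: (x \in E); rewrite // sEvs.
Qed.

Lemma count_mem_le vs E : uniq vs -> count (mem E) vs <= #|E|.
Proof.
move=> Uvs; rewrite count_mem_set //; apply: subset_leq_card.
by apply/subsetP=> x; rewrite inE => /andP[].
Qed.

Lemma count_mem_full vs E :
  uniq vs -> count (mem E) vs = #|E| -> {subset E <= vs}.
Proof.
move=> Uvs; rewrite count_mem_set // => eqE.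
have: [set x in E | x \in vs] == E.
  rewrite eqEcard eqE leqnn andbT.
  by apply/subsetP=> x; rewrite inE => /andP[].
by move=> /eqP eE x; rewrite -{1}eE inE => /andP[].
Qed.

Lemma nth_trace x0 vs E i : i < size vs -> nth false (trace vs E) i = (nth x0 vs i \in E).
Proof. exact: nth_map. Qed.

Lemma trace_inj vs E F : {subset E <= vs} -> {subset F <= vs} ->
  trace vs E = trace vs F -> E = F.
Proof.
move=> sE sF /eq_in_map eqEF; apply/setP=> x.
have [/eqEF // | xvs] := boolP (x \in vs).
by rewrite (contraNF (sE x)) ?(contraNF (sF x)).
Qed.

Variables (H : {set {set T}}) (m : nat).
Hypothesis H4 : {in H, forall E, #|E| = 4}.
Hypothesis Hm : {in H &, forall E F, E != F -> 0 < #|E :&: F| <= m}.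
Hypothesis Hflag : forall E e, E \in H -> e \in E ->
  3 < #|[set F in H | E :&: F == [set e]]|.

Definition consistent vs K C : Prop :=
  [/\ uniq vs,
      {in K, forall X, exists2 E, E \in H & {subset E <= vs} /\ X = trace vs E}
    & {in H, forall E, trace vs E \in C}].

Definition unavoidable vs op : Prop := exists2 F, F \in H & trace vs F \in op.

Lemma compat_trace vs E F : uniq vs -> E \in H -> F \in H -> {subset F <= vs} ->
  compat m (trace vs F) (trace vs E).
Proof.
move=> Uvs EH FH sF; rewrite /compat inter_trace count_mem_sub //; last first.
  by move=> x; rewrite inE => /andP[_ /sF].
have cE: count id (trace vs E) <= 4.
  by rewrite count_trace -(H4 EH) count_mem_le.
have [eqEF|neq] := eqVneq E F; first by rewrite -eqEF setIid H4 //= orbT cE.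
have /andP[] := Hm EH FH neq.
by case: #|_| => // c _ ->.
Qed.

Lemma trace_full vs F : uniq vs -> F \in H -> count id (trace vs F) = 4 ->
  {subset F <= vs}.
Proof. by move=> Uvs FH; rewrite count_trace -(H4 FH); apply: count_mem_full. Qed.

Lemma narrow_unavoidable vs K C E best i :
  consistent vs K C -> trace vs E \in K -> unavoidable vs best ->
  unavoidable vs (narrow [seq X <- K | if inter X (trace vs E) is 1 then true else false]
    [seq X <- C | if inter X (trace vs E) is 1 then ~~ has (same X) K else false]
    (trace vs E) best i).
Proof.
move=> [Uvs KP CP] EK bestP; rewrite /narrow.
case: ifP => // Ei; set K1 := filter _ K; set C1 := filter _ C.
set kn := count _ K1; set unk := filter _ C1.
case: ifP => // /andP[kn4 _].
have [E' E'H [sE' eqE]] := KP _ EK; rewrite eqE in Ei K1 C1 kn unk kn4 *.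
have i_lt: i < size vs.
  by rewrite ltnNge; apply: contraTN Ei => le; rewrite nth_default // size_map.
have [x0 _]: exists x0 : T, true by case: (vs) i_lt => // x; exists x.
have eE' : nth x0 vs i \in E' by rewrite -(nth_trace x0).
set e := nth x0 vs i in eE'.
pose G := [set F in H | E' :&: F == [set e]].
have GH F : F \in G -> F \in H by rewrite inE => /andP[].
have G1 F : F \in G -> inter (trace vs F) (trace vs E') = 1 /\ nth false (trace vs F) i.
  rewrite inE => /andP[FH /eqP EF]; rewrite inter_trace setIC EF.
  rewrite count_mem_sub ?cards1 ?(nth_trace x0) //; last first.
    by move=> x /set1P ->; apply: mem_nth.
  split=> //; have: e \in E' :&: F by rewrite EF set11.
  by rewrite inE => /andP[].
have G4 : 3 < #|G| := Hflag E'H eE'.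
pose G' := [set F in G | trace vs F \notin K].
have hasK X : has (same X) K = (X \in K).
  by apply/hasP/idP=> [[Y YK /sameP ->] //|XK]; exists X => //; apply/sameP.
have unkP F : F \in G' -> trace vs F \in unk.
  rewrite inE => /andP[FG FK]; have [i1 n1] := G1 _ FG.
  by rewrite !mem_filter n1 i1 hasK FK CP // GH.
(* Known edges lie inside [vs] and are thus determined by their traces, so at most [kn] edges of [G]
   are known. *)
have cardG' : 4 - kn <= #|G'|.
  have GD F : F \in G :\: G' -> F \in G /\ trace vs F \in K.
    by rewrite in_setD => /andP[+ FG]; rewrite in_set FG negbK.
  have: #|G :\: G'| <= kn.
    rewrite /kn -size_filter cardE -(size_map (trace vs)).
    apply: uniq_leq_size; last first.
      move=> _ /mapP[F + ->]; rewrite mem_enum => /GD[FG FK].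
      by have [i1 n1] := G1 _ FG; rewrite !mem_filter n1 i1 FK.
    rewrite map_inj_in_uniq ?enum_uniq // => F1 F2.
    have known F : F \in G :\: G' -> {subset F <= vs}.
      move=> /GD[FG FK]; have [F' F'H [sF' eqF]] := KP _ FK.
      apply: trace_full (GH _ FG) _ => //.
      by rewrite eqF count_trace count_mem_sub ?H4.
    by rewrite !mem_enum => /known s1 /known s2; apply: trace_inj.
  have sG : G' \subset G by apply/subsetP=> F; rewrite in_set => /andP[].
  rewrite cardsD (setIidPr sG); lia.
case: ifP => [/allP full|_]; last first.
  have /card_gt0P[F FG'] : 0 < #|G'| by lia.
  by exists F; [move: FG'; rewrite inE => /andP[/GH]|apply: unkP].
pose t := size unk + kn - 3.
have [/existsP[F /andP[FG' Ft]]|] :=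
    boolP [exists F, (F \in G') && (trace vs F \in take t unk)].
  by exists F => //; move: FG'; rewrite inE => /andP[/GH].
rewrite negb_exists => /forallP none.
(* Here distinct edges of [G'] have distinct traces; if none survived in the prefix, all would be
   among the at most [3 - kn] dropped ones. *)
have: #|G'| <= size (drop t unk).
  rewrite cardE -(size_map (trace vs)); apply: uniq_leq_size.
    rewrite map_inj_in_uniq ?enum_uniq // => F1 F2; rewrite !mem_enum => F1G F2G.
    have fullG F : F \in G' -> {subset F <= vs}.
      move=> FG'; apply: trace_full => //; first by move: FG'; rewrite inE => /andP[/GH].
      by apply/eqP/full/unkP.
    by apply: trace_inj; apply: fullG.
  move=> _ /mapP[F + ->]; rewrite mem_enum => FG'.
  have := unkP _ FG'; rewrite -{1}(cat_take_drop t unk) mem_cat.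
  by have := none F; rewrite FG' /= => /negPf ->.
rewrite size_drop /t; lia.
Qed.

Lemma choose_unavoidable vs K C Es best :
  consistent vs K C -> {subset Es <= K} -> unavoidable vs best ->
  unavoidable vs (choose K C Es best).
Proof.
move=> cons; have [Uvs KP CP] := cons.
elim: Es best => //= E Es IH best sEs bestP; case: ifP => // _.
apply: IH => [X XEs|]; first by apply: sEs; rewrite inE XEs orbT.
have EK : E \in K by apply: sEs; rewrite inE eqxx.
have [F FH [sF eqE]] := KP _ EK; subst E.
elim: (iota _ _) best bestP => //= i s IHs best bestP.
exact/IHs/narrow_unavoidable.
Qed.

Lemma consistent_extend vs K C F : consistent vs K C -> F \in H ->
  let X := trace vs F in let f := 4 - count id X in let N := X ++ nseq f true in
  consistent (vs ++ enum (F :\: [set x in vs])) (N :: [seq Y ++ nseq f false | Y <- K])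
    [seq W <- [seq Y ++ Z | Y <- C, Z <- bits f] | compat m N W].
Proof.
move=> [Uvs KP CP] FH X f N; set ws := enum _.
have wsP x : x \in ws = (x \in F) && (x \notin vs).
  by rewrite mem_enum !inE andbC.
have Uws : uniq (vs ++ ws).
  rewrite cat_uniq Uvs enum_uniq andbT /=; apply/hasPn=> x.
  by rewrite wsP => /andP[].
have size_ws : size ws = f.
  rewrite -cardE cardsD /f count_trace count_mem_set // H4 //.
  by congr (_ - #|pred_of_set _|); apply/setP=> x; rewrite !inE.
have sF : {subset F <= vs ++ ws}.
  by move=> x xF; rewrite mem_cat wsP xF; case: (x \in vs).
have traceF : trace (vs ++ ws) F = N.
  rewrite /trace map_cat -/(trace vs F); congr (_ ++ _).
  apply: (@eq_from_nth _ false); rewrite ?size_map ?size_nseq // => i i_lt.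
  have [x0 _]: exists x0 : T, true by case: (ws) i_lt => // x; exists x.
  rewrite (nth_map x0) // nth_nseq -size_ws i_lt.
  by have := mem_nth x0 i_lt; rewrite wsP => /andP[].
have traceE E : {subset E <= vs} -> trace (vs ++ ws) E = trace vs E ++ nseq f false.
  move=> sE; rewrite /trace map_cat; congr (_ ++ _).
  apply: (@eq_from_nth _ false); rewrite ?size_map ?size_nseq // => i i_lt.
  have [x0 _]: exists x0 : T, true by case: (ws) i_lt => // x; exists x.
  rewrite (nth_map x0) // nth_nseq if_same.
  have := mem_nth x0 i_lt; rewrite wsP => /andP[_ nvs].
  by apply: contraNF nvs => /sE.
split=> //.
- move=> Y; rewrite inE => /orP[/eqP->|/mapP[X' /KP[E EH [sE ->]] ->]].
    by exists F => //; split.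
  exists E => //; split; last by rewrite traceE.
  by move=> x /sE xvs; rewrite mem_cat xvs.
- move=> E EH; rewrite mem_filter -traceF compat_trace //=.
  rewrite /trace map_cat; apply: allpairs_f; first exact: CP.
  by rewrite -size_ws -(size_map (mem E) ws) bitsP.
Qed.

(** Some candidate is the trace of an actual edge. At the first such candidate the state extends
    consistently, so [r] fails there; the candidates before it can be removed from [C] without
    losing an edge. *)
Lemma refute_all_sound (r : seq bitseq -> seq bitseq -> bool) vs K C op :
  (forall vs' K' C', consistent vs' K' C' -> r K' C' = false) ->
  consistent vs K C -> unavoidable vs op -> refute_all r m K C op = false.
Proof.
move=> rP; elim: op C => [|X op IH] C cons [F FH Fop] //=.
case: ifP => // rT.
have XnH E : E \in H -> trace vs E != X.
  move=> EH; apply/eqP=> eX; subst X.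
  by rewrite (rP _ _ _ (consistent_extend cons EH)) in rT.
apply: IH.
  have [Uvs KP CP] := cons; split=> // E EH.
  rewrite mem_filter CP // andbT; apply/sameP/eqP; exact: XnH.
by exists F => //; move: Fop; rewrite inE (negPf (XnH _ FH)).
Qed.

Lemma refute_sound d vs K C : H != set0 -> consistent vs K C -> refute d m K C = false.
Proof.
move=> /set0Pn[F FH]; elim: d vs K C => //= d IH vs K C cons.
have [_ _ CP] := cons.
apply: (refute_all_sound IH cons); apply: choose_unavoidable => //.
by exists F; rewrite ?CP.
Qed.

Lemma refute_start_sound vs (Es : seq {set T}) : uniq vs -> Es != [::] ->
  {in Es, forall E, E \in H /\ {subset E <= vs}} ->
  refute_start m [seq trace vs E | E <- Es] = false.
Proof.
case: Es => // E0 Es Uvs _ EsP; apply: (@refute_sound _ vs).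
  by apply/set0Pn; exists E0; have [] := EsP E0 (mem_head _ _).
split=> // [X /mapP[E /EsP[EH sE] ->]|E EH]; first by exists E.
rewrite mem_filter; apply/andP; split.
  by apply/allP=> X /mapP[F /EsP[FH sF] ->]; apply: compat_trace.
by rewrite [head _ _]/= !size_map -(size_map (mem E) vs) bitsP.
Qed.

Lemma trace_const vs E b :
  {in vs, forall x, (x \in E) = b} -> trace vs E = nseq (size vs) b.
Proof.
elim: vs => //= x vs IH xE; rewrite xE ?mem_head // IH // => y yvs.
by rewrite xE // inE yvs orbT.
Qed.

(** Listing the common points first, then those of [E] only, then those of [F] only, turns the two
    traces into [meeting_pair d], which soundness forbids to refute. *)
Lemma meet_neq d E F : E \in H -> F \in H -> refute_start m (meeting_pair d) ->
  #|E :&: F| != d.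
Proof.
move=> EH FH; apply: contraTneq => dE.
pose vs := enum (E :&: F) ++ enum (E :\: F) ++ enum (F :\: E).
have Uvs : uniq vs.
  rewrite !cat_uniq !enum_uniq !andbT /=; apply/andP; split.
    by apply/hasPn=> x; rewrite mem_cat !mem_enum !inE; case: (x \in E); case: (x \in F).
  by apply/hasPn=> x; rewrite !mem_enum !inE; case: (x \in E); case: (x \in F).
have cE : #|E :\: F| = 4 - d by rewrite cardsD dE H4.
have cF : #|F :\: E| = 4 - d by rewrite cardsD setIC dE H4.
have tE : trace vs E = nseq d true ++ nseq (4 - d) true ++ nseq (4 - d) false.
  by rewrite /trace !map_cat -!/(trace _ _) (@trace_const _ _ true)
    ?(@trace_const (enum (E :\: F)) _ true)
    ?(@trace_const (enum (F :\: E)) _ false) -?cardE ?dE ?cE ?cF // => x; rewrite mem_enum inE => /andP[] // /negPf.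
have tF : trace vs F = nseq d true ++ nseq (4 - d) false ++ nseq (4 - d) true.
  by rewrite /trace !map_cat -!/(trace _ _) (@trace_const _ _ true)
    ?(@trace_const (enum (E :\: F)) _ false)
    ?(@trace_const (enum (F :\: E)) _ true) -?cardE ?dE ?cE ?cF // => x; rewrite mem_enum inE => /andP[] // /negPf.
rewrite /meeting_pair -tE -tF -[[:: _; _]]/(map (trace vs) [:: E; F]).
rewrite refute_start_sound // => A; rewrite !inE => /orP[] /eqP->; split=> // x xA;
  by rewrite !mem_cat !mem_enum !inE xA; case: (x \in _).
Qed.

End Soundness.

(* If every flag had at least four such edges, the computations [refute_meet3] and
   [refute_meet2] would force distinct edges to share one point only; but then an
   edge missing [e] meets the edges through [e] in distinct points, so there are
   at most four of those, one fewer than required. *)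
Lemma flag_bound (T : finType) (H : {set {set T}}) :
  H != set0 -> {in H, forall E : {set T}, #|E| = 4} ->
  {in H &, forall E F : {set T}, E :&: F != set0} ->
  exists E e, [/\ E \in H, e \in E & #|[set F in H | E :&: F == [set e]]| <= 3].
Proof.
move=> /set0Pn[E0 E0H] H4 HI.
pose P E e := [&& E \in H, e \in E & #|[set F in H | E :&: F == [set e]]| <= 3].
have [/existsP[E /existsP[e /and3P[]]]|] := boolP [exists E, exists e, P E e].
  by exists E, e.
rewrite negb_exists => /forallP noP; exfalso.
have Hflag E e : E \in H -> e \in E -> 3 < #|[set F in H | E :&: F == [set e]]|.
  move=> EH eE; have := noP E; rewrite negb_exists => /forallP/(_ e).
  by rewrite /P EH eE ltnNge.
have H3 : {in H &, forall E F : {set T}, E != F -> 0 < #|E :&: F| <= 3}.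
  move=> E F EH FH; rewrite card_gt0 HI //= leqNgt; apply: contraNN => c4.
  have c4' : #|E| <= #|E :&: F| by rewrite H4.
  have /eqP/setIidPl sEF : E :&: F == E by rewrite eqEcard subsetIl.
  by rewrite eqEcard sEF !H4.
(* Excluding intersections of size 3 is what allows the second search to run with [m = 2]. *)
have H2 : {in H &, forall E F : {set T}, E != F -> 0 < #|E :&: F| <= 2}.
  move=> E F EH FH EF; have := H3 E F EH FH EF.
  have := meet_neq H4 H3 Hflag EH FH refute_meet3; lia.
have H1 : {in H &, forall E F : {set T}, E != F -> #|E :&: F| = 1}.
  move=> E F EH FH EF; have := H2 E F EH FH EF.
  have := meet_neq H4 H2 Hflag EH FH refute_meet2; lia.
have /card_gt0P[e eE] : 0 < #|E0| by rewrite H4.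
have /card_gt0P[e'] : 0 < #|E0 :\ e| by have := cardsD1 e E0; rewrite eE H4 //; lia.
rewrite !inE => /andP[e'e e'E].
have /card_gt0P[G] : 0 < #|[set F in H | E0 :&: F == [set e']]|.
  exact: leq_ltn_trans (Hflag _ _ E0H e'E).
rewrite inE => /andP[GH /eqP EG].
have eG : e \notin G.
  apply: contraNN e'e => eG; have: e \in [set e'] by rewrite -EG inE eE.
  by rewrite inE eq_sym.
have eE0F F : F \in [set F in H | E0 :&: F == [set e]] -> (F \in H) /\ (e \in F).
  rewrite inE => /andP[FH /eqP E0F]; split=> //.
  have: e \in E0 :&: F by rewrite E0F set11.
  by case/setIP.
pose A := E0 |: [set F in H | E0 :&: F == [set e]].
have AP F : F \in A -> (F \in H) /\ (e \in F).
  by rewrite in_setU1 => /orP[/eqP->|/eE0F].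
have cA : 4 < #|A|.
  rewrite cardsU1 inE setIid; have := Hflag _ _ E0H eE.
  suff -> : (E0 == [set e]) = false by rewrite andbF.
  by apply/eqP=> E0e; have := H4 _ E0H; rewrite E0e cards1.
(* On [A] the default is never taken, since members of [H] intersect. Two edges of [A] share only
   [e], which is not in [G], so [g] is injective there. *)
pose g F := odflt e [pick x in F :&: G].
have gP F : F \in A -> g F \in F :&: G.
  move=> /AP[FH _]; rewrite /g; case: pickP => //= none.
  by have /set0Pn[x] := HI F G FH GH; rewrite none.
have g_inj : {in A &, injective g}.
  move=> F1 F2 F1A F2A g12; apply/eqP; apply: contraTT isT => neq.
  have [[F1H eF1] [F2H eF2]] := (AP _ F1A, AP _ F2A).
  have [/setIP[x1 xG] /setIP[x2 _]] := (gP _ F1A, gP _ F2A); rewrite -g12 in x2.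
  have /eqP/cards1P[z eqz] := H1 _ _ F1H F2H neq.
  have /set1P ez : e \in [set z] by rewrite -eqz inE eF1.
  have /set1P gz : g F1 \in [set z] by rewrite -eqz inE x1.
  by rewrite gz -ez (negPf eG) in xG.
have: #|g @: A| <= #|G|.
  by apply/subset_leq_card/subsetP=> _ /imsetP[F /gP/setIP[_ ?] ->].
by rewrite card_in_imset // (H4 _ GH) leqNgt cA.
Qed.

(** * Generating families and branching *)

Lemma card_bigcup_le (I T : finType) (P : {set I}) (f : I -> {set T}) c :
  {in P, forall i, #|f i| <= c} -> #|\bigcup_(i in P) f i| <= #|P| * c.
Proof.
move=> fc; rewrite -sum_nat_const.
apply: (big_ind2 (fun (A : {set T}) m => #|A| <= m)) => [|A a B b Aa Bb|i /fc //].
  by rewrite cards0.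
by apply: leq_trans (leq_add Aa Bb); rewrite cardsU leq_subr.
Qed.

Section Families.
Variable n : nat.
Implicit Types (A B D E S : {set 'I_n}) (H G R U : {set {set 'I_n}}).

Lemma intersectingP H :
  reflect {in H &, forall A B, A :&: B != set0} (intersecting H).
Proof.
apply: (iffP forall_inP) => [HI A B AH BH|HI A AH].
  by have /forall_inP -> := HI A AH.
by apply/forall_inP=> B; apply: HI.
Qed.

Definition covered k H S : {set {set 'I_n}} :=
  [set A : {set 'I_n} | [&& #|A| == k, [disjoint A & S] & [exists B in H, B \subset A]]].

Lemma covered_subset k H U S : H \subset U -> covered k H S \subset covered k U S.
Proof.
move=> HU; apply/subsetP=> A; rewrite !inE => /and3P[-> -> /exists_inP[B BH BA]].
by apply/exists_inP; exists B; rewrite ?(subsetP HU).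
Qed.

Lemma card_supersets k B S : [disjoint B & S] -> #|B| <= k ->
  #|covered k [set B] S| <= 'C(n - (#|B| + #|S|), k - #|B|).
Proof.
move=> BS Bk.
have <- : #|~: (B :|: S)| = n - (#|B| + #|S|).
  by rewrite cardsCs setCK card_ord cardsU disjoint_setI0 // cards0 subn0.
have covP A : A \in covered k [set B] S ->
    [/\ #|A| = k, [disjoint A & S] & B \subset A].
  by rewrite inE => /and3P[/eqP ? ? /exists_inP[_ /set1P->]].
rewrite -cards_draws -(@card_in_imset _ _ (fun A => A :\: B) (covered k [set B] S)).
  apply/subset_leq_card/subsetP=> _ /imsetP[A /covP[Ak AS BA] ->].
  rewrite inE cardsD (setIidPr BA) Ak eqxx andbT.
  rewrite setDE setCU setIC; apply: setIS.
  by rewrite -disjoints_subset.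
move=> A1 A2 /covP[_ _ /setIidPr B1] /covP[_ _ /setIidPr B2] eqD.
by rewrite -(setID A1 B) -(setID A2 B) B1 B2 eqD.
Qed.

Lemma card_covered_uniform k l R S : {in R, forall B, #|B| = l} -> l <= k ->
  #|covered k R S| <= #|avoid R S| * 'C(n - (l + #|S|), k - l).
Proof.
move=> Rl lk; apply: leq_trans (card_bigcup_le (f := fun B => covered k [set B] S) _).
  apply/subset_leq_card/subsetP=> A; rewrite inE => /and3P[Ak AS /exists_inP[B BR BA]].
  apply/bigcupP; exists B; first by rewrite inE BR (disjointWl BA).
  by rewrite inE Ak AS; apply/exists_inP; exists B; rewrite ?set11.
move=> B; rewrite inE => /andP[/Rl Bl BS].
by rewrite -Bl; apply: card_supersets; rewrite ?Bl.
Qed.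

(** * Counting by branching *)

Definition star R S D : {set {set 'I_n}} := [set B in avoid R S | D \subset B].

Lemma card_star_step R S D E c : {in R, forall B, E :&: B != set0} ->
  {in E :\: S, forall x, #|star R S (x |: D)| <= c} ->
  #|star R S D| <= #|E :\: S| * c.
Proof.
move=> ER Ec; apply: leq_trans (card_bigcup_le Ec).
apply/subset_leq_card/subsetP=> B; rewrite inE => /andP[BRS DB].
have /andP[BR BS] : (B \in R) && [disjoint B & S] by rewrite inE in BRS.
have /set0Pn[x /setIP[xE xB]] := ER _ BR.
apply/bigcupP; exists x; first by rewrite inE xE (disjointFr BS xB).
by rewrite inE BRS subUset sub1set xB.
Qed.

(** [c j] bounds the branches at a partial set of size [j]. As [E] misses [D], each chosen point
    enlarges [D], and it lies outside [S]; at size [l] only [D] itself can remain. *)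
Lemma card_star l (c : nat -> nat) R S D0 : {in R, forall B, #|B| = l} ->
  (forall D B, D0 \subset D -> #|D| < l -> B \in R -> D \subset B ->
     exists E, [/\ {in R, forall B', E :&: B' != set0}, [disjoint E & D]
                 & #|E :\: S| <= c #|D|]) ->
  #|D0| <= l -> #|star R S D0| <= \prod_(#|D0| <= j < l) c j.
Proof.
move=> Rl branch; have : D0 \subset D0 by []; move: {-1}D0 => D sD Dl.
have [m mE] : exists m, m = l - #|D| by exists (l - #|D|).
elim: m D sD Dl mE => [|m IH] D sD Dl mE.
  have eDl : #|D| = l by lia.
  rewrite eDl big_geq // -(cards1 D); apply/subset_leq_card/subsetP=> B.
  rewrite !inE => /andP[/andP[BR _] DB].
  by rewrite eq_sym eqEcard DB eDl Rl /=.
have [->|/set0Pn[B]] := eqVneq (star R S D) set0; first by rewrite cards0.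
rewrite !inE => /andP[/andP[BR _] DB].
have Dltl : #|D| < l by lia.
have [E [ER ED Ec]] := branch D B sD Dltl BR DB.
rewrite big_ltn //; apply: leq_trans (leq_mul Ec (leqnn _)).
apply: card_star_step => // x; rewrite inE => /andP[_ xE].
have xD : #|x |: D| = #|D|.+1 by rewrite cardsU1 (disjointFr ED xE).
by rewrite -xD; apply: IH; rewrite ?xD ?(subset_trans sD) ?subsetUr //; lia.
Qed.

(** * Saturated families and the descent to size 5 *)

Definition saturated l U : Prop := forall D, #|D| <= l -> D != set0 ->
  {in U, forall E, E :&: D != set0} -> D \in U.

(** Take [U] maximal under inclusion: adding a transversal of size at most [l] keeps it
    intersecting. Nonemptiness of [D] makes [D] meet itself. *)
Lemma saturate l H : intersecting H -> {in H, forall A, #|A| <= l} ->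
  exists U, [/\ intersecting U, {in U, forall A, #|A| <= l}, H \subset U
    & saturated l U].
Proof.
move=> HI Hl; pose P U := intersecting U && [forall A in U, #|A| <= l].
have PH : P H by rewrite /P HI; apply/forall_inP.
have [U /maxsetP[/andP[UI /forall_inP Ul] Umax] HU] := maxset_exists PH.
exists U; split=> // D Dl D0 DU; rewrite -(Umax (D |: U)) ?subsetUr ?setU11 //.
apply/andP; split; last by apply/forall_inP=> A /setU1P[->|/Ul].
apply/intersectingP=> A B /setU1P[->|AU] /setU1P[->|BU].
- by rewrite setIid.
- by rewrite setIC DU.
- exact: DU.
- exact: (intersectingP _ UI).
Qed.

Definition minimal_members l U : {set {set 'I_n}} :=
  [set B in U | (#|B| == l) && [forall D in U, ~~ (D \proper B)]].

Definition short_members l U : {set {set 'I_n}} := [set B in U | #|B| < l].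

(** An [l]-set with a proper subset in [U] can be replaced by that subset, which is short. *)
Lemma covered_split k l U S : {in U, forall A, #|A| <= l} ->
  covered k U S \subset
  covered k (minimal_members l U) S :|: covered k (short_members l U) S.
Proof.
move=> Ul; apply/subsetP=> A; rewrite !inE => /and3P[-> -> /exists_inP[B BU BA]] /=.
have [Bl|] := ltnP #|B| l.
  by apply/orP; right; apply/exists_inP; exists B; rewrite ?inE ?BU.
move=> lB; have Bl : #|B| == l by rewrite eqn_leq Ul.
have [Bmin|] := boolP [forall D in U, ~~ (D \proper B)].
  by apply/orP; left; apply/exists_inP; exists B; rewrite ?inE ?BU ?Bl.
rewrite negb_forall => /existsP[D]; rewrite negb_imply negbK => /andP[DU DB].
apply/orP; right; apply/exists_inP; exists D; last exact: subset_trans (proper_sub DB) BA.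
by rewrite inE DU (leq_trans (proper_card DB)) ?(eqP Bl).
Qed.

(* By saturation no proper subset of a minimal member is a transversal of U. *)
Lemma missing_member l U D B :
  intersecting U -> saturated l U ->
  #|D| < l -> B \in minimal_members l U -> D \subset B ->
  exists2 E, E \in U & [disjoint E & D].
Proof.
move=> UI Usat Dl; rewrite inE => /and3P[BU /eqP Bl /forall_inP Bmin] DB.
have DpB : D \proper B by rewrite properEcard DB Bl.
apply/exists_inP; apply: contraT; rewrite negb_exists_in => /forall_inP noE.
have DU E : E \in U -> E :&: D != set0 by move=> EU; rewrite setI_eq0 noE.
have /Bmin : D \in U.
  apply: (Usat _ (ltnW Dl) _ DU); apply: contraNneq (DU B BU) => ->.
  by rewrite setI0.
by rewrite DpB.
Qed.

Lemma minimal_members_meet l U :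
  intersecting U ->
  {in U, forall E, {in minimal_members l U, forall B, E :&: B != set0}}.
Proof.
move=> UI E EU B; rewrite inE => /andP[BU _]; exact: (intersectingP _ UI).
Qed.

Lemma card_minimal_members l U S :
  intersecting U -> {in U, forall A, #|A| <= l} -> saturated l U ->
  #|avoid (minimal_members l U) S| <= l ^ l.
Proof.
move=> UI Ul Usat.
have -> : avoid (minimal_members l U) S = star (minimal_members l U) S set0.
  by apply/setP=> B; rewrite [RHS]inE sub0set andbT.
have -> : l ^ l = \prod_(#|@set0 'I_n| <= j < l) l.
  by rewrite cards0 prod_nat_const_nat subn0.
apply: (@card_star l (fun=> l)); rewrite ?cards0 //.
  by move=> B; rewrite inE => /and3P[_ /eqP].
move=> D B _ Dl BR DB; have [E EU ED] := missing_member UI Usat Dl BR DB.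
exists E; split=> //; first exact: minimal_members_meet.
by apply: leq_trans (Ul _ EU); rewrite subset_leq_card ?subsetDl.
Qed.

Lemma reduce_step k l H : l <= k ->
  intersecting H -> {in H, forall A, #|A| <= l} ->
  exists U, [/\ intersecting U, {in U, forall A, #|A| < l}
    & forall S, #|covered k H S| <=
                #|covered k U S| + l ^ l * 'C(n - (l + #|S|), k - l)].
Proof.
move=> lk HI Hl; have [U [UI Ul HU Usat]] := saturate HI Hl.
exists (short_members l U); split.
- apply/intersectingP=> A B; rewrite !inE => /andP[AU _] /andP[BU _].
  exact: (intersectingP _ UI).
- by move=> A; rewrite inE => /andP[].
move=> S; rewrite addnC.
have sHU := subset_trans (covered_subset k S HU) (covered_split k S Ul).
apply: leq_trans (subset_leq_card sHU) _.
rewrite (leq_trans (leq_card_setU _ _)) // leq_add2r.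
apply: leq_trans (card_covered_uniform S _ lk) _.
  by move=> B; rewrite inE => /and3P[_ /eqP].
by rewrite leq_mul2r card_minimal_members ?orbT.
Qed.

Lemma reduce_to5 k l H : 5 <= l <= k ->
  intersecting H -> {in H, forall A, #|A| <= l} ->
  exists U, [/\ intersecting U, {in U, forall A, #|A| <= 5}
    & forall S, #|covered k H S| <=
      #|covered k U S| + \sum_(6 <= j < l.+1) j ^ j * 'C(n - (j + #|S|), k - j)].
Proof.
move=> /andP[]; elim: l H => // l IH H.
rewrite leq_eqVlt => /orP[/eqP<- k5 HI H5|l5 lk HI Hl].
  by exists H; split=> // S; rewrite big_geq // addn0.
have [U [UI Ul HU]] := reduce_step lk HI Hl.
have [V [VI V5 UV]] := IH U l5 (ltnW lk) UI Ul.
exists V; split=> // S; rewrite big_nat_recr //= addnA.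
by apply: leq_trans (HU S) _; rewrite leq_add2r.
Qed.

(** * Families of small sets that no triple covers *)

Lemma superset_of_card m D :
  #|D| <= m <= n -> exists2 S : {set 'I_n}, D \subset S & #|S| = m.
Proof.
move=> /andP[Dm mn]; have [d dE] : exists d, d = m - #|D| by eexists.
elim: d D Dm dE => [|d IH] D Dm dE; first by exists D => //; lia.
have /card_gt0P[x] : 0 < #|~: D| by rewrite cardsCs setCK card_ord; lia.
rewrite inE => xD; have cx : #|x |: D| = #|D|.+1 by rewrite cardsU1 xD.
have [||S sS Sm] := IH (x |: D); rewrite ?cx; try lia.
by exists S => //; apply: subset_trans sS; apply: subsetUr.
Qed.

Lemma no_small_cover G : 3 <= n ->
  (forall S, #|S| = 3 -> avoid G S != set0) ->
  forall D, #|D| <= 3 -> exists2 E, E \in G & [disjoint E & D].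
Proof.
move=> n3 GS D D3; have [|S DS S3] := @superset_of_card 3 D; first by rewrite D3.
have /set0Pn[E] := GS S S3; rewrite inE => /andP[EG ES].
by exists E => //; apply: disjointWr ES.
Qed.

(** An edge with at most three points would be missed by some member of [G], although [G] is
    intersecting. *)
Lemma uniform_of_no_cover G : 3 <= n -> intersecting G ->
  {in G, forall E, #|E| <= 4} ->
  (forall S, #|S| = 3 -> avoid G S != set0) -> {in G, forall E, #|E| = 4}.
Proof.
move=> n3 GI G4 GS E EG; apply/eqP; rewrite eqn_leq G4 //= leqNgt ltnS.
apply/negP=> E3; have [E' E'G] := no_small_cover n3 GS E3.
by rewrite -setI_eq0; apply/negP/(intersectingP _ GI).
Qed.

(** An edge avoiding [A :\ e] still meets [A], hence exactly in [e], so the flag given by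
    [flag_bound] serves. *)
Lemma sparse_flag G : 3 <= n -> intersecting G ->
  {in G, forall E, #|E| <= 4} ->
  (forall S, #|S| = 3 -> avoid G S != set0) ->
  exists A e, [/\ A \in G, e \in A & #|avoid G (A :\ e)| <= 3].
Proof.
move=> n3 GI G4 GS; have G4' := uniform_of_no_cover n3 GI G4 GS.
have [E0 E0G _] := no_small_cover n3 GS (leqW (leqW (leqW (eq_leq (cards0 'I_n))))).
have G0 : G != set0 by apply/set0Pn; exists E0.
have [A [e [AG eA Ae]]] := flag_bound G0 G4' (intersectingP _ GI).
exists A, e; split=> //; apply: leq_trans Ae; apply/subset_leq_card/subsetP=> F.
rewrite !inE => /andP[FG FA]; rewrite FG /=; apply/eqP/setP=> x; rewrite !inE.
have := intersectingP _ GI A F AG FG => /set0Pn[y /setIP[yA yF]].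
have sub z : z \in A -> z \in F -> z = e.
  move=> zA zF; apply/eqP; apply: contraFT (disjointFr FA zF) => ze.
  by rewrite !inE ze.
apply/andP/eqP=> [[xA xF]|->]; first exact: sub.
by rewrite -(sub y yA yF).
Qed.

(* Every member of [U] missing [e] meets [A] inside [A :\ e], which leaves one
   branching choice less: three at each of the levels 1, 2, 3, where a set with at
   most four points can be used, and four at level 4. *)
Lemma card_minimal_members5 U A e : 
  intersecting U -> {in U, forall A, #|A| <= 5} -> saturated 5 U ->
  3 <= n -> (forall S, #|S| = 3 -> avoid (short_members 5 U) S != set0) ->
  A \in short_members 5 U -> e \in A ->
  #|avoid (minimal_members 5 U) (A :\ e)| <= 108.
Proof.
move=> UI U5 Usat n3 noS AU eA; set S := A :\ e; set R := minimal_members 5 U.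
have AU' : A \in U by move: AU; rewrite inE => /andP[].
(* A member avoiding [S] must meet [A] in [e], so the branching starts at size 1. *)
have -> : avoid R S = star R S [set e].
  apply/setP=> B; rewrite [RHS]inE sub1set; case BRS: (B \in _) => //=.
  move: BRS; rewrite inE => /andP[BR BS].
  have /set0Pn[x /setIP[xA xB]] := minimal_members_meet UI AU' BR.
  suff <- : x = e by [].
  apply/eqP; apply: contraFT (disjointFr BS xB) => xe.
  by rewrite !inE xe.
pose c j := if j < 4 then 3 else 4.
have -> : 108 = \prod_(#|[set e]| <= j < 5) c j by rewrite cards1 unlock.
apply: card_star; rewrite ?cards1 //.
  by move=> B; rewrite inE => /and3P[_ /eqP].
have ES E D : E \in U -> [set e] \subset D -> [disjoint E & D] -> #|E :\: S| < #|E|.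
  rewrite sub1set => EU eD ED; apply: proper_card; rewrite properE subsetDl.
  have /set0Pn[x /setIP[xA xE]] := intersectingP _ UI A E AU' EU.
  apply/subsetPn; exists x => //; rewrite !inE xA xE !andbT negbK.
  by apply: contraTneq xE => ->; rewrite (disjointFl ED eD).
move=> D B eD D5 BR DB; rewrite /c; case: ltnP => D4.
  have [E EU ED] := no_small_cover n3 noS D4.
  move: EU; rewrite inE => /andP[EU E4].
  exists E; split=> //; first exact: minimal_members_meet.
  by rewrite -ltnS (leq_trans (ES E D EU eD ED)).
have [E EU ED] := missing_member UI Usat D5 BR DB.
exists E; split=> //; first exact: minimal_members_meet.
by rewrite -ltnS (leq_trans (ES E D EU eD ED)) ?U5.
Qed.

End Families.

(** * Numerical estimates *)

(** An integer form of (1 + 1/j)^j <= 3: by induction, (1 + 1/j)^i <= 1 + i/j + (i/j)^2 for i <=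
    j. *)
Lemma expn_succ_le j : 0 < j -> j.+1 ^ j <= 3 * j ^ j.
Proof.
move=> j0.
have le i : i <= j -> j.+1 ^ i * j ^ 2 <= j ^ i * (j ^ 2 + i * j + i ^ 2).
  elim: i => [|i IH] ij; first by rewrite !expn0 !mul1n !addn0.
  rewrite (expnS j.+1) (expnS j i) -!mulnA.
  apply: leq_trans (leq_mul (leqnn _) (IH (ltnW ij))) _.
  rewrite mulnCA [j * (_ * _)]mulnCA leq_mul2l; apply/orP; right.
  by rewrite !expnS !expn0; nia.
have := le j (leqnn j); have -> : j ^ 2 + j * j + j ^ 2 = 3 * j ^ 2 by nia.
by rewrite mulnCA mulnA leq_pmul2r // expn_gt0 j0.
Qed.

Lemma bin_shift a b j : j < b -> j < a ->
  (a - j) * 'C(a - j.+1, b - j.+1) = (b - j) * 'C(a - j, b - j).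
Proof.
by move=> jb ja; rewrite (subnS a) mul_bin_diag (subnS b) prednK // subn_gt0.
Qed.

Section Tail.
Variables n k : nat.
Hypothesis nk : 71 * k ^ 2 <= n.

Definition tail_term j := j ^ j * 'C(n - (j + 3), k - j).

(** The power grows by a factor of at most 3(j+1) and the binomial shrinks by (k-j)/(n-j-3), so the
    claim reduces to 6(j+1)(k-j) <= n-j-3. *)
Lemma tail_term_halve j : 6 <= j < k -> 2 * tail_term j.+1 <= tail_term j.
Proof.
move=> /andP[j6 jk]; rewrite /tail_term.
have kk : k ^ 2 = k * k by rewrite mulnn.
have N0 : 0 < n - (j + 3) by nia.
rewrite -(leq_pmul2l N0) addSn.
have E : (n - (j + 3)) * 'C(n - (j + 3).+1, k - j.+1) = (k - j) * 'C(n - (j + 3), k - j).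
  have -> : n - (j + 3).+1 = n - 3 - j.+1 by lia.
  have -> : n - (j + 3) = n - 3 - j by lia.
  by apply: bin_shift; lia.
rewrite [in leqLHS]mulnCA [in leqLHS](mulnCA _ (j.+1 ^ j.+1)) E.
rewrite [leqRHS]mulnA [in leqLHS]mulnA [in leqLHS]mulnA leq_mul2r; apply/orP; right.
rewrite expnS; have := expn_succ_le (leq_trans _ j6 : 0 < j).
move=> /(_ isT); move: (j.+1 ^ j) (j ^ j) => u v uv.
apply: (@leq_trans (6 * (j.+1 * (k - j)) * v)).
  rewrite mulnAC -mulnA [_ * (j.+1 * u)]mulnCA -[6]/(2 * 3) !mulnA.
  rewrite [_ * 3]mulnC -!mulnA; move: (leq_mul (leqnn (2 * j.+1 * (k - j))) uv); lia.
rewrite leq_mul2r; apply/orP; right; nia.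
Qed.

Lemma tail_sum_le m : 6 <= m <= k -> \sum_(m <= j < k.+1) tail_term j <= 2 * tail_term m.
Proof.
have [d dE] : exists d, d = k - m by eexists.
elim: d m dE => [|d IH] m dE /andP[m6 mk].
  have -> : m = k by lia.
  by rewrite big_nat1 leq_pmull.
rewrite big_ltn //; apply: leq_trans (leq_add (leqnn _) (IH m.+1 _ _)) _; try lia.
rewrite [leqRHS]mul2n -addnn leq_add2l; apply: tail_term_halve; lia.
Qed.

Lemma tail_bound : 5 <= k ->
  \sum_(6 <= j < k.+1) tail_term j <= 68 * 'C(n - 8, k - 5).
Proof.
rewrite leq_eqVlt => /orP[/eqP <-|k6]; first by rewrite big_geq.
apply: leq_trans (tail_sum_le _) _; first by rewrite leqnn.
have kk : k ^ 2 = k * k by rewrite mulnn.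
(* This is (k-10)^2 >= 0; it linearizes the quadratic inequality 2 * 6^6 * (k-5) <= 68 * (n-8) near
   its tightest point. *)
have k1 : 20 * k <= k * k + 100 by case: (leqP k 10) => ?; nia.
have N0 : 0 < n - 8 by nia.
rewrite /tail_term -[6 + 3]/9 -(leq_pmul2l N0).
have E : (n - 8) * 'C(n - 9, k - 6) = (k - 5) * 'C(n - 8, k - 5).
  have -> : n - 9 = n - 3 - 6 by lia.
  have -> : n - 8 = n - 3 - 5 by lia.
  by apply: bin_shift; lia.
rewrite mulnCA [in leqLHS](mulnCA _ (6 ^ 6)) E !mulnA leq_mul2r; apply/orP; right.
lia.
Qed.

(** This serves the case where a triple meets all short members: the crude count 5^5 is affordable
    because C(n-7, k-4) is (n-7)/(k-4) times C(n-8, k-5). *)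
Lemma main_term_bound : 5 <= k ->
  (5 ^ 5 + 68) * 'C(n - 8, k - 5) <= 3 * 'C(n - 7, k - 4) + 108 * k * 'C(n - 8, k - 5).
Proof.
move=> k5; have kk : k ^ 2 = k * k by rewrite mulnn.
(* This is (k-6)^2 >= 0, again tangent near the tightest [k]. *)
have k1 : 12 * k <= k * k + 36 by case: (leqP k 6) => ?; nia.
have E : (n - 7) * 'C(n - 8, k - 5) = (k - 4) * 'C(n - 7, k - 4).
  have -> : n - 8 = n - 3 - 5 by lia.
  have -> : n - 7 = n - 3 - 4 by lia.
  apply: bin_shift; nia.
have k40 : 0 < k - 4 by lia.
rewrite -(leq_pmul2l k40) mulnDr [_ * (3 * _)]mulnCA -E !mulnA -mulnDl leq_mul2r.
apply/orP; right.
have -> : 5 ^ 5 = 25 * 125 by [].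
nia.
Qed.

End Tail.

(** * Choice of the triple and the final bound *)

Lemma gamma3_le n (F : {set {set 'I_n}}) (S : {set 'I_n}) :
  #|S| = 3 -> gamma3 F <= #|avoid F S|.
Proof.
move=> S3; rewrite /gamma3; elim: (index_enum _) (mem_index_enum S) => // A s IH.
rewrite inE big_cons => /orP[/eqP<-|/IH le]; first by rewrite S3 geq_minl.
by case: ifP => // _; rewrite geq_min le orbT.
Qed.

Lemma avoid_covered n k (F : {set {set 'I_n}}) (S : {set 'I_n}) :
  {in F, forall A : {set 'I_n}, #|A| = k} -> #|avoid F S| <= #|covered k F S|.
Proof.
move=> Fk; apply/subset_leq_card/subsetP=> A; rewrite !inE => /andP[AF ->].
by rewrite Fk // eqxx; apply/exists_inP; exists A.
Qed.

Lemma sparse_triple4 n (G : {set {set 'I_n}}) : 3 <= n -> intersecting G ->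
  {in G, forall E : {set 'I_n}, #|E| <= 4} ->
  exists2 S : {set 'I_n}, #|S| = 3 & #|avoid G S| <= 3.
Proof.
move=> n3 GI G4.
have [/existsP[S /andP[/eqP S3 /eqP GS]]|] :=
    boolP [exists S : {set 'I_n}, (#|S| == 3) && (avoid G S == set0)].
  by exists S; rewrite // GS cards0.
rewrite negb_exists => /forallP noS.
have GS (S : {set 'I_n}) : #|S| = 3 -> avoid G S != set0.
  by move=> S3; have := noS S; rewrite S3.
have [A [e [AG eA Ae]]] := sparse_flag n3 GI G4 GS.
exists (A :\ e) => //; have := cardsD1 e A.
by rewrite eA (uniform_of_no_cover n3 GI G4 GS) // => -[].
Qed.

Lemma gamma3_bound5 n k (F : {set {set 'I_n}}) :
  5 <= k -> 71 * k ^ 2 <= n -> {in F, forall A : {set 'I_n}, #|A| = k} ->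
  intersecting F -> gamma3 F <= 3 * 'C(n - 7, k - 4) + 108 * k * 'C(n - 8, k - 5).
Proof.
move=> k5 nk Fk FI.
have n3 : 3 <= n by apply: leq_trans nk; rewrite -mulnn; nia.
have Fk' : {in F, forall A : {set 'I_n}, #|A| <= k} by move=> A /Fk->.
have [|U [UI U5 FU]] := reduce_to5 (k := k) _ FI Fk'; first by rewrite k5 leqnn.
have [V [VI V5 UV Vsat]] := saturate UI U5.
set R := minimal_members 5 V; set G := short_members 5 V.
have R5 : {in R, forall B : {set 'I_n}, #|B| = 5}.
  by move=> B; rewrite inE => /and3P[_ /eqP].
have GV : {subset G <= V} by move=> E; rewrite inE => /andP[].
have GI : intersecting G.
  by apply/intersectingP=> A B /GV AV /GV BV; apply: (intersectingP _ VI).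
have G4 : {in G, forall E : {set 'I_n}, #|E| <= 4} by move=> E; rewrite inE => /andP[].
(* The terms come from the short members, the minimal 5-sets, and the losses at levels 6 to [k], at
   most 68 binomials together. *)
have bound (S : {set 'I_n}) :
  #|S| = 3 -> gamma3 F <=
    #|covered k G S| + (#|avoid R S| + 68) * 'C(n - 8, k - 5).
  move=> S3; apply: leq_trans (gamma3_le F S3) _.
  apply: leq_trans (avoid_covered S Fk) _; apply: leq_trans (FU S) _.
  rewrite mulnDl addnA S3 leq_add ?(tail_bound nk k5) //.
  have sUV := subset_trans (covered_subset k S UV) (covered_split k S V5).
  apply: leq_trans (subset_leq_card sUV) _.
  rewrite addnC (leq_trans (leq_card_setU _ _)) // leq_add2r.
  by have := card_covered_uniform S R5 k5; rewrite S3.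
have [/existsP[S /andP[/eqP S3 /eqP GS]]|] :=
    boolP [exists S : {set 'I_n}, (#|S| == 3) && (avoid G S == set0)].
  apply: leq_trans (bound S S3) _.
  have -> : covered k G S = set0.
    apply/setP=> A; rewrite !inE; apply/negP=> /and3P[_ AS /exists_inP[B BG BA]].
    have : B \in avoid G S by rewrite inE BG (disjointWl BA).
    by rewrite GS inE.
  rewrite cards0 add0n; apply: leq_trans (main_term_bound nk k5).
  by rewrite leq_mul2r leq_add2r card_minimal_members ?orbT.
rewrite negb_exists => /forallP noS.
have GS (S : {set 'I_n}) : #|S| = 3 -> avoid G S != set0.
  by move=> S3; have := noS S; rewrite S3.
have [A [e [AG eA Ae]]] := sparse_flag n3 GI G4 GS.
have G4' := uniform_of_no_cover n3 GI G4 GS.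
have S3 : #|A :\ e| = 3 by have := cardsD1 e A; rewrite eA G4' // => -[].
apply: leq_trans (bound _ S3) _; apply: leq_add.
  apply: leq_trans (card_covered_uniform _ G4' (ltnW k5)) _.
  by rewrite S3 leq_mul2r Ae orbT.
rewrite leq_mul2r; apply/orP; right.
apply: leq_trans (leq_add (card_minimal_members5 VI V5 Vsat n3 GS AG eA) (leqnn 68)) _.
(* 108 + 68 <= 108 * k holds since k >= 5. *)
lia.
Qed.

Theorem theorem1p3 (n k : nat) (F : {set {set 'I_n}}) :
  4 <= k -> 71 * k ^ 2 <= n ->
  (forall A, A \in F -> #|A| = k) ->
  intersecting F ->
  gamma3 F <= 3 * binomz (n - 7) (k%:Z - 4)%R + 108 * k * binomz (n - 8) (k%:Z - 5)%R.
Proof.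
rewrite leq_eqVlt => /orP[/eqP<- n4 Fk FI|k5 nk Fk FI].
  have [||S S3 FS] := @sparse_triple4 n F _ FI; first exact: leq_trans n4.
    by move=> A /Fk->.
  apply: leq_trans (gamma3_le F S3) _.
  (* At [k = 4] the first lower index is 0, so the first summand equals 3. *)
  by rewrite (leq_trans FS) // -[binomz _ _]/'C(n - 7, 0) bin0 leq_addr.
rewrite [(_ - 4)%R]subzn ?(ltnW k5) // [(_ - 5)%R]subzn //.
exact: gamma3_bound5.
Qed.
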